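(* Let $d_1(n),d_2(n),D_1(n),D_2(n)$ be integer-valued functions which for all large $n$ satisfy (a) $d_1(n)\le\min\{5,d_2(n),D_2(n)\}$ and $D_1(n)\le D_2(n)$, and (b) $d_2(n)>0$ and $D_1(n)=n-o(n)$. Then $$\mathbf{P}[P_{n,d_1,d_2,D_1,D_2}\text{ is connected}]\to1\quad\text{as } n\to\infty.$$
   Context: $\mathcal{P}(n,d_1,d_2,D_1,D_2)$ denotes the set of simple labelled planar graphs on $\{1,\ldots,n\}$ with minimum degree in $[d_1(n),d_2(n)]$ and maximum degree in $[D_1(n),D_2(n)]$; $P_{n,d_1,d_2,D_1,D_2}$ is a graph chosen uniformly at random from this set. *)

(* Defs.v *)
From HB Require Import structures.
From mathcomp Require Import all_boot all_order all_algebra.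
From mathcomp Require Import all_classical all_reals all_analysis.

Set Implicit Arguments.
Unset Strict Implicit.
Unset Printing Implicit Defensive.

Import Order.TTheory GRing.Theory Num.Theory.
Import numFieldNormedType.Exports.

Local Open Scope classical_set_scope.
Local Open Scope ring_scope.

(* Simple labelled graphs on n vertices: the label set {1, ..., n} is
   represented by 'I_n, and an edge is an unordered pair of vertices. *)
Record sgraph (n : nat) := SGraph {
  edges : {set {set 'I_n}};
  _ : [forall e in edges, #|e| == 2%N]
}.

HB.instance Definition _ n := [isSub for @edges n].
HB.instance Definition _ n := [Finite of sgraph n by <:].

Definition adj n (G : sgraph n) : rel 'I_n :=
  fun x y => [set x; y]%SET \in edges G.

Definition deg n (G : sgraph n) (x : 'I_n) : nat := #|[set y | adj G x y]|.

(* Every degree is less than n, so the default value n of the minimum is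
   irrelevant as soon as there is a vertex. *)
Definition min_deg n (G : sgraph n) : nat := (\big[minn/n]_(x < n) deg G x)%N.

Definition max_deg n (G : sgraph n) : nat := (\max_(x < n) deg G x)%N.

Definition connected_graph n (G : sgraph n) : bool :=
  [forall x, forall y, connect (adj G) x y].

(* [pt] and [arc] draw G in the plane without crossings: the vertices are
   distinct points, every edge e is the simple arc arc e @` `[0, 1] joining its
   two endpoints, and the interior of an arc meets no vertex and no other edge
   (a common point of an interior and an end of another arc would be a vertex,
   so comparing interiors is enough). *)
Definition plane_drawing (R : realType) n (G : sgraph n)
    (pt : 'I_n -> R * R) (arc : {set 'I_n} -> R -> R * R) : Prop :=
  [/\ injective pt,
      (forall e, e \in edges G ->
        [/\ {within `[0, 1], continuous (arc e)},
            {in `[0, 1] &, injective (arc e)} &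
            [set arc e 0; arc e 1] = [set pt x | x in [set` e]]]),
      (forall e x (t : R), e \in edges G -> t \in `]0, 1[ -> arc e t <> pt x) &
      (forall e f (s t : R), e \in edges G -> f \in edges G -> e != f ->
        s \in `]0, 1[ -> t \in `]0, 1[ -> arc e s <> arc f t)].

Definition planar (R : realType) n (G : sgraph n) : Prop :=
  exists (pt : 'I_n -> R * R) (arc : {set 'I_n} -> R -> R * R),
    plane_drawing G pt arc.

Definition planar_class (R : realType) (n : nat) (d1 d2 D1 D2 : int) :
    {set sgraph n} :=
  [set G | [&& `[< planar R G >],
               d1 <= (min_deg G)%:Z <= d2 &
               D1 <= (max_deg G)%:Z <= D2]]%SET.

(* Probability that a uniformly random element of A satisfies B; it is only
   meaningful when A is nonempty. *)
Definition uniform_pr (R : realType) (T : finType) (A : {set T}) (B : pred T) :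
    R :=
  #|[set x in A | B x]|%:R / #|A|%:R.

(* Main.v *)
(* Let k = n - D1, which is o(n), and let v be a vertex of maximum degree, so that
   v has at most k non-neighbours. Disconnected graphs of the class are compared
   with the whole class by two switchings.

   If fewer than n/2 vertices have degree at least max_deg - 1, there are at least
   n/4 neighbours x of v such that adding an edge from x to a suitable vertex y
   outside the component of v stays in the class. The result still determines v,
   and together with y it determines the original graph; y is one of at most k
   non-neighbours of v. So these graphs have proportion O(k/n).

   If at least n/2 vertices have such a high degree, deleting an edge ab between two
   of them (avoiding v) stays in the class, which can be done in at least n^2/16
   ways, and it is undone by choosing a and one of its at most k+2 non-neighbours b.
   So the proportion is again O(k/n). This replaces any appeal to the fact that
   planar graphs are sparse: planarity is used only through its preservation when
   an edge is deleted, or added between two components.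

   For the latter, a drawing is first straightened near x, so that the edges at x
   leave along radii of a small square and a free radius remains. The same is done
   at y in a second copy of the drawing. An inversion centred at the end of the free radius of
   y turns that radius into a ray to infinity; shrinking the image and placing it at
   the end of the free radius of x, one joins x to y by a straight segment. *)
Require Import Defs.
From mathcomp Require Import all_boot all_order all_algebra.
From mathcomp Require Import all_classical all_reals all_analysis.
From mathcomp Require Import ring lra zify.

Import Order.TTheory GRing.Theory Num.Theory.
Import numFieldNormedType.Exports.

Local Open Scope classical_set_scope.
Local Open Scope ring_scope.

Set Implicit Arguments.
Unset Strict Implicit.
Unset Printing Implicit Defensive.

(** * Curves in the plane *)

Section Curves.
Context {R : realType}.
Implicit Types (t : R) (z : R * R).

(** Retraction of the line onto the unit interval. Composing with it turns a curve known to be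
    continuous on [[0, 1]] only into one continuous everywhere. *)
Definition clamp t : R := Num.max 0 (Num.min 1 t).

Lemma clamp_itv t : clamp t \in `[0, 1].
Proof. by rewrite in_itv /= /clamp le_max lexx /= ge_max ler01 /= ge_min lexx. Qed.

Lemma clamp_id t : t \in `[0, 1] -> clamp t = t.
Proof. by rewrite in_itv /clamp /= => /andP[t0 t1]; rewrite min_r ?max_r. Qed.

Lemma clamp_continuous : continuous clamp.
Proof.
move=> t; apply: (@continuous_max R R (cst 0) (fun t => Num.min 1 t)).
  exact: cst_continuous.
apply: (@continuous_min R R (cst 1) id); first exact: cst_continuous.
exact: cvg_id.
Qed.

Lemma continuous_clamped (T : topologicalType) (f : R -> T) :
  {within `[0, 1], continuous f} -> continuous (f \o clamp).
Proof.
move=> /subspace_continuousP cf t.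
apply: (@cvg_comp _ _ _ clamp f _ (within `[0, 1] (nbhs (clamp t)))); last first.
  by apply: cf; exact: clamp_itv.
move=> A wA; have cA := clamp_continuous wA.
by apply: (@filterS _ (nbhs t)) cA => s /=; apply; exact: clamp_itv.
Qed.

Lemma normp_continuous (f : R -> R * R) :
  {within `[0, 1], continuous f} -> {within `[0, 1], continuous (fun t => `|f t|)}.
Proof.
move=> cf; apply: (@within_continuous_comp _ _ _ _ f (fun z => `|z|)) => //.
by move=> z _; exact: norm_continuous.
Qed.

Lemma arc_away (f : R -> R * R) p : {within `[0, 1], continuous f} ->
  (forall t, t \in `[0, 1] -> f t <> p) ->
  exists2 c : R, 0 < c & forall t, t \in `[0, 1] -> c <= `|f t - p|.
Proof.
move=> cf fp.
have /EVT_min[//|c c01 cmin] : {within `[0, 1], continuous (fun t => `|f t - p|)}.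
  apply: normp_continuous.
  apply: (@within_continuous_comp _ _ _ _ f (fun z => z - p)) => //.
  by move=> z _; apply: cvgB; [exact: cvg_id | exact: cvg_cst].
exists `|f c - p| => //; rewrite normr_gt0 subr_eq0; apply/eqP; exact: fp.
Qed.

(** The time [s] is the supremum of the times with value at most [r]. Continuity gives [h s <= r],
    and a strict inequality would yield a later such time by the intermediate value theorem. *)
Lemma last_exit (h : R -> R) r : {within `[0, 1], continuous h} ->
  h 0 < r -> r < h 1 ->
  exists s, [/\ 0 < s < 1, h s = r & forall t, s < t <= 1 -> r < h t].
Proof.
move=> ch h0 h1; pose S := [set s | (0 <= s <= 1) /\ h s <= r].
have S0 : S 0 by split; [rewrite lexx ler01 | exact: ltW].
have hS : has_sup S by split; [exists 0 | exists 1 => s [/andP[]]].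
pose s := sup S.
have s01 : 0 <= s <= 1.
  by rewrite ub_le_sup //=; [apply: sup_le_ub => [|t [/andP[]//]]; exists 0 | case: hS].
have sin : s \in `[0, 1] by [].
have after t : s < t <= 1 -> r < h t.
  move=> /andP[st t1]; rewrite ltNge; apply/negP => htr.
  have : S t by split => //; rewrite t1 (le_trans _ (ltW st)) //; case/andP: s01.
  by move=> /(ub_le_sup (proj2 hS)); rewrite leNgt st.
have hs_le : h s <= r.
  rewrite leNgt; apply/negP => rhs.
  have := @continuous_clamped _ h ch s; move=> /cvgr_gt /(_ r).
  rewrite /= (clamp_id sin) => /(_ rhs) /nbhs_ballP[e /= e0 he].
  have [u Su su] := sup_adherent e0 hS.
  have us : u <= s by apply: ub_le_sup => //; case: hS.
  have : r < h (clamp u).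
    by apply: he; rewrite /ball /= ger0_norm ?subr_ge0 //; move: su; rewrite -/s; lra.
  case: Su => u01 hu; rewrite clamp_id ?in_itv //.
  by rewrite ltNge hu.
have s_lt1 : s < 1.
  by case/andP: s01 => _; rewrite le_eqVlt => /orP[/eqP s1|//]; move: hs_le; rewrite s1; lra.
have hs : h s = r.
  apply/eqP; rewrite eq_le hs_le /= leNgt; apply/negP => hsr.
  have [||c c1 hc] := @IVT R h s 1 r (ltW s_lt1).
  - apply: continuous_subspaceW ch => t; rewrite /= !in_itv /= => /andP[st ->].
    by rewrite (le_trans _ st) //; case/andP: s01.
  - by rewrite ge_min le_max (ltW hsr) (ltW h1) orbT.
  - move: c1; rewrite in_itv /= le_eqVlt => /andP[/orP[/eqP sc|sc] c1].
      by move: hsr; rewrite sc hc ltxx.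
    by have := after c; rewrite sc c1 hc ltxx => /(_ isT).
exists s; split => //; rewrite s_lt1 andbT lt_neqAle; case/andP: s01 => -> _.
by rewrite andbT; apply: contraPneq hs => <-; lra.
Qed.

End Curves.

(** * Plane drawings *)

Section Drawings.
Context {R : realType} {n : nat}.
Implicit Types (G : sgraph n) (pt : 'I_n -> R * R)
  (arc : {set 'I_n} -> R -> R * R) (e f : {set 'I_n}).

Lemma edge_card G e : e \in edges G -> #|e| = 2%N.
Proof. by case: G => E /= /forall_inP cE /cE /eqP. Qed.

Lemma adj_sym G : symmetric (adj G).
Proof. by move=> x y; rewrite /adj finset.setUC. Qed.

Lemma conn_sym G : connect_sym (adj G).
Proof. exact/sym_connect_sym/adj_sym. Qed.

Lemma image_pair pt (a b : 'I_n) :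
  [set pt x | x in [set` [set a; b]%SET]] = [set pt a; pt b].
Proof.
apply/seteqP; split => [z [u /=]|z [->|->]].
- by rewrite !inE => /orP[] /eqP -> <-; [left | right].
- by exists a => //=; rewrite !inE eqxx.
- by exists b => //=; rewrite !inE eqxx orbT.
Qed.

Lemma arc_ends G pt arc e : plane_drawing G pt arc -> e \in edges G ->
  exists a b, [/\ e = [set a; b]%SET, a != b, arc e 0 = pt a & arc e 1 = pt b].
Proof.
move=> [_ hE _ _] eG; have [_ inj ends] := hE e eG.
have [a ae pa] : [set pt x | x in [set` e]] (arc e 0) by rewrite -ends; left.
have [b be pb] : [set pt x | x in [set` e]] (arc e 1) by rewrite -ends; right.
have ab : a != b.
  apply/eqP => ab; move: pa; rewrite ab pb => /inj.
  by rewrite !in_itv /= !lexx ler01 => /(_ isT isT); lra.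
exists a, b; split => //; apply/esym/eqP; rewrite eqEcard (edge_card eG) cards2 ab leqnn.
by rewrite andbT; apply/fintype.subsetP => u; rewrite !inE => /orP[] /eqP ->.
Qed.

Lemma arc_at_vertex G pt arc e t u : plane_drawing G pt arc ->
  e \in edges G -> t \in `[0, 1] -> arc e t = pt u -> u \in e.
Proof.
move=> dG eG; rewrite in_itv /= => /andP[t0 t1] etu.
have [a [b [eab ab ea eb]]] := arc_ends dG eG; case: dG => ptI _ hV _.
move: t0 t1; rewrite !le_eqVlt => /orP[/eqP t0|t0] /orP[/eqP t1|t1].
- by move: etu; rewrite -t0 ea => /ptI <-; rewrite eab !inE eqxx.
- by move: etu; rewrite -t0 ea => /ptI <-; rewrite eab !inE eqxx.
- by move: etu; rewrite t1 eb => /ptI <-; rewrite eab !inE eqxx orbT.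
- by case: (hV e u t) => //; rewrite in_itv /= t0.
Qed.

Definition drawn_set G pt arc : set (R * R) :=
  [set z | (exists u, z = pt u) \/
           (exists e t, [/\ e \in edges G, t \in `[0, 1] & z = arc e t])].

Lemma drawn_set_pt G pt arc u : drawn_set G pt arc (pt u).
Proof. by left; exists u. Qed.

Lemma drawn_set_arc G pt arc e t : e \in edges G -> t \in `[0, 1] ->
  drawn_set G pt arc (arc e t).
Proof. by move=> eG t01; right; exists e, t. Qed.

(** Continuity and injectivity are asked only on the drawing itself, so that an inversion centred
    off the drawing qualifies. *)
Lemma drawing_map G pt arc (phi : R * R -> R * R) : plane_drawing G pt arc ->
  (forall z, drawn_set G pt arc z -> {for z, continuous phi}) ->
  {in drawn_set G pt arc &, injective phi} ->
  plane_drawing G (phi \o pt) (fun e => phi \o arc e).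
Proof.
move=> dG cphi Iphi; have [ptI hE hV hA] := dG.
have I z w : drawn_set G pt arc z -> drawn_set G pt arc w -> phi z = phi w -> z = w.
  by move=> sz sw; apply: Iphi; rewrite inE.
have S e t : e \in edges G -> t \in `]0, 1[ -> drawn_set G pt arc (arc e t).
  by move=> eG t01; apply: drawn_set_arc => //; exact: subset_itv_oo_cc.
split.
- by move=> u v /I uv; apply/ptI/uv; exact: drawn_set_pt.
- move=> e eG; have [ce Ie ends] := hE e eG; split.
  + apply: within_continuous_comp ce => z; rewrite inE => -[t t01 <-].
    by apply: cphi; exact: drawn_set_arc.
  + by move=> s t s01 t01 /I h; apply: Ie => //; apply: h; exact: drawn_set_arc.
  + have [a [b [eab ab ea eb]]] := arc_ends dG eG.
    by rewrite /= ea eb eab image_pair.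
- move=> e u t eG t01 /I h; apply: (hV e u t eG t01); apply: h.
    exact: S.
  exact: drawn_set_pt.
- by move=> e f s t eG fG ef s01 t01 /I h; apply: (hA e f s t) => //; apply: h; exact: S.
Qed.

Lemma drawn_set_map G pt arc (phi : R * R -> R * R) z :
  drawn_set G (phi \o pt) (fun e => phi \o arc e) z ->
  exists2 w, drawn_set G pt arc w & z = phi w.
Proof.
case=> [[u ->]|[e [t [eG t01 ->]]]]; [exists (pt u) | exists (arc e t)] => //.
  exact: drawn_set_pt.
exact: drawn_set_arc.
Qed.

(** Each arc is compact, hence at positive distance from [p]; finitely many arcs and vertices then
    share one bound. *)
Lemma drawn_set_away G pt arc p : plane_drawing G pt arc ->
  ~ drawn_set G pt arc p ->
  exists2 c : R, 0 < c & forall z, drawn_set G pt arc z -> c <= `|z - p|.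
Proof.
move=> dG np; have [_ hE _ _] := dG.
have [c [c0 [hc1 hc2]]] : exists c : R, 0 < c /\
    ((forall u, c < `|pt u - p|) /\
    forall e, e \in edges G -> forall t, t \in `[0, 1] -> c < `|arc e t - p|).
  near (0 : R)^'+ => c; exists c; split; first by near: c; exact: nbhs_right_gt.
  split; near: c.
    apply: filter_forall => u; apply: nbhs_right_lt; rewrite normr_gt0 subr_eq0; apply/eqP => up.
    by apply: np; rewrite -up; exact: drawn_set_pt.
  apply: filter_forall => e.
  have [eG|neG] := boolP (e \in edges G); last by near=> c.
  have [ce _ _] := hE e eG.
  have [t t01 ep|d d0 hd] := arc_away (p := p) ce.
    by apply: np; rewrite -ep; exact: drawn_set_arc.
  near=> c => _ t t01; apply: lt_le_trans (hd t t01).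
  by near: c; exact: nbhs_right_lt.
exists c => // z [[u ->]|[e [t [eG t01 ->]]]]; apply: ltW; first exact: hc1.
exact: hc2.
Unshelve. all: by end_near. Qed.

(** A drawing orients its arcs arbitrarily, whereas straightening at [x] wants every arc at [x] to
    start there. Clamping also makes the arcs continuous on the whole line. *)
Lemma reorient G pt arc (o : pred {set 'I_n}) : plane_drawing G pt arc ->
  exists arc', [/\ plane_drawing G pt arc',
    forall e, e \in edges G -> continuous (arc' e) &
    forall e, arc' e 0 = if o e then arc e 1 else arc e 0].
Proof.
move=> dG; have [ptI hE hV hA] := dG.
pose fl e (t : R) := if o e then 1 - t else t.
have flc e t : t \in `[0, 1] -> fl e t \in `[0, 1].
  by rewrite /fl !in_itv /= => /andP[t0 t1]; case: ifP => _; lra.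
have flo e t : t \in `]0, 1[ -> fl e t \in `]0, 1[.
  by rewrite /fl !in_itv /= => /andP[t0 t1]; case: ifP => _; lra.
have flI e : injective (fl e).
  by move=> s t; rewrite /fl; case: (o e) => h; lra.
have oc (t : R) : t \in `]0, 1[ -> t \in `[0, 1] := @subset_itv_oo_cc _ _ _ _ t.
have i0 : (0 : R) \in `[0, 1] by rewrite in_itv /= lexx ler01.
have i1 : (1 : R) \in `[0, 1] by rewrite in_itv /= lexx ler01.
pose arc' e t := arc e (clamp (fl e t)).
have E e t : t \in `[0, 1] -> arc' e t = arc e (fl e t).
  by move=> t01; rewrite /arc' clamp_id ?flc.
have cont e : e \in edges G -> continuous (arc' e).
  move=> eG; have [/continuous_clamped ce _ _] := hE e eG.
  move=> t; apply: (@cvg_comp _ _ _ (fl e) (arc e \o clamp) _ (nbhs (fl e t))).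
    rewrite /fl; case: (o e); last exact: cvg_id.
    by apply: cvgB; [exact: cvg_cst | exact: cvg_id].
  exact: ce.
exists arc'; split => //; last first.
  by move=> e; rewrite E // /fl; case: ifP; rewrite ?subr0.
split => //.
- move=> e eG; have [ce Ie ends] := hE e eG; split.
  + by apply: continuous_subspaceT; exact: cont.
  + move=> s t s01 t01; rewrite !E // => /Ie h; apply: (@flI e); apply: h; exact: flc.
  + rewrite !E // -ends /fl; case: (o e) => //.
    by rewrite subr0 subrr setUC.
- by move=> e u t eG t01; rewrite E ?oc //; apply: hV => //; exact: flo.
- move=> e f s t eG fG ef s01 t01; rewrite !E ?oc //; apply: hA => //; exact: flo.
Qed.

End Drawings.

(* Irrelevant universally quantified hypotheses slow the arithmetic solvers down. *)
Ltac drop_foralls := repeat match goal with H : forall _, _ |- _ => clear H end.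
Ltac slra := drop_foralls; lra.
Ltac snra := drop_foralls; nra.

(** * Straightening a drawing near one vertex *)

Section Straighten.
Context {R : realType} {n : nat}.
Implicit Types (G : sgraph n) (pt : 'I_n -> R * R)
  (arc : {set 'I_n} -> R -> R * R) (e f : {set 'I_n}).

(** The norm on pairs is the maximum norm, so [(r, c)] with [0 < c < r] lies on the square of radius
    [r]. A small enough [c] differs from all the finitely many second coordinates. *)
Lemma free_direction (I : finType) (b : I -> R * R) (r : R) : 0 < r ->
  exists q : R * R, `|q| = r /\ forall i, q != b i.
Proof.
move=> r0.
have key i : \forall c \near (0 : R)^'+, c != (b i).2.
  have [b0|b0] := leP (b i).2 0.
    near=> c; rewrite gt_eqF // (le_lt_trans b0) //; near: c; exact: nbhs_right_gt.
  near=> c; rewrite lt_eqF //; near: c; exact: nbhs_right_lt.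
near (0 : R)^'+ => c; exists (r, c).
have c0 : 0 < c by near: c; exact: nbhs_right_gt.
have cr : c < r by near: c; exact: nbhs_right_lt.
split; first by rewrite prod_normE /= !gtr0_norm // max_l // ltW.
suff cb : forall i, c != (b i).2 by move=> i; apply: contraNneq (cb i) => <-.
by near: c; exact: filter_forall key.
Unshelve. all: by end_near. Qed.

(* Each arc at [x] is cut at its last exit from a small square around [pt x] that
   meets nothing else, and the initial piece is replaced by a radius. *)
Lemma straighten_arcs G pt arc (x : 'I_n) : plane_drawing G pt arc ->
  (forall e, e \in edges G -> continuous (arc e)) -> pt x = 0 ->
  (forall e, e \in edges G -> x \in e -> arc e 0 = 0) ->
  exists arc' q, [/\ plane_drawing G pt arc', q != 0 &
    forall t : R, 0 < t <= 1 -> ~ drawn_set G pt arc' (t *: q)].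
Proof.
move=> dG cG ptx arcx; have [ptI hE hV hA] := dG.
have i0 : 0 <= (0 : R) <= 1 by rewrite lexx ler01.
have i1 : 0 <= (1 : R) <= 1 by rewrite lexx ler01.
have c2 : continuous (fun t : R => 2 * t) by move=> t; exact: mulrl_continuous.
have cw e : e \in edges G -> {within `[0, 1], continuous (arc e)}.
  by move=> eG; have [] := hE e eG.
have [r [r0 hpt harc]] : exists r : R, [/\ 0 < r, (forall u, u != x -> r < `|pt u|) &
    forall e, e \in edges G -> x \notin e -> forall t, t \in `[0, 1] -> r < `|arc e t| ].
  near (0 : R)^'+ => r; exists r; split.
  - by near: r; exact: nbhs_right_gt.
  - near: r; apply: filter_forall => u; have [->|ux] := eqVneq u x; first by near=> r.
    near=> r => _; near: r; apply: nbhs_right_lt; rewrite normr_gt0 -ptx.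
    by apply: contra_neq ux => /ptI.
  - near: r; apply: filter_forall => e.
    have [eG|neG] := boolP (e \in edges G); last by near=> r.
    have [xe|nxe] := boolP (x \in e); first by near=> r.
    have [t t01|d d0 hd] := arc_away (p := 0) (cw e eG).
      by rewrite -ptx => /(arc_at_vertex dG eG t01); apply/negP.
    near=> r => _ _ t t01; have := hd t t01; rewrite subr0; apply: lt_le_trans.
    by near: r; exact: nbhs_right_lt.
have arc1 e : e \in edges G -> x \in e -> r < `|arc e 1|.
  move=> eG xe; have [a [b [eab ab ea eb]]] := arc_ends dG eG.
  rewrite eb; apply: hpt; rewrite eq_sym; apply: contra_neq ab => <-.
  by apply: ptI; rewrite -ea ptx arcx.
have [s_ hs] : {s_ : {set 'I_n} -> R & forall e, e \in edges G -> x \in e ->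
    [/\ 0 < s_ e < 1, `|arc e (s_ e)| = r & forall t, s_ e < t <= 1 -> r < `|arc e t| ]}.
  apply: (@choice _ _ (fun e s => e \in edges G -> x \in e ->
    [/\ 0 < s < 1, `|arc e s| = r & forall t, s < t <= 1 -> r < `|arc e t| ])) => e.
  have [eG|neG] := boolP (e \in edges G); last by exists 0.
  have [xe|nxe] := boolP (x \in e); last by exists 0.
  have [||s ?] := last_exit (r := r) (normp_continuous (cw e eG)); last by exists s.
    by rewrite arcx // normr0.
  exact: arc1.
(* Up to time 1/2 the new arc follows the radius to the exit point [arc e (s_ e)]; afterwards it
   follows the old arc from time [s_ e] to 1. A single formula for both halves makes continuity
   immediate. *)
pose arc' e (t : R) := if x \in e then
  Num.min 1 (2 * t) *: arc e (s_ e + Num.max 0 (2 * t - 1) * (1 - s_ e)) else arc e t.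
have out e t : x \notin e -> arc' e t = arc e t by rewrite /arc' => /negPf ->.
have cas e t : e \in edges G -> x \in e -> 0 <= t <= 1 ->
    (t <= 1/2 /\ arc' e t = (2 * t) *: arc e (s_ e)) \/
    (1/2 < t /\ arc' e t = arc e (s_ e + (2 * t - 1) * (1 - s_ e))).
  move=> eG xe t01; rewrite /arc' xe; have [th|th] := leP t (1/2); [left|right].
    rewrite min_r ?max_l; [|slra|slra].
    by rewrite mul0r addr0.
  by rewrite min_l ?max_r ?scale1r //; slra.
have late e t : e \in edges G -> x \in e -> 1/2 < t <= 1 ->
    s_ e < s_ e + (2 * t - 1) * (1 - s_ e) <= 1.
  by move=> eG xe ?; have [? _ _] := hs e eG xe; snra.
have norm_early e (t : R) : e \in edges G -> x \in e -> 0 <= t ->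
    `|(2 * t) *: arc e (s_ e)| = 2 * t * r.
  move=> eG xe t0; have [_ sr _] := hs e eG xe.
  by rewrite normrZ sr ger0_norm //; slra.
have norm_late e t : e \in edges G -> x \in e -> 1/2 < t <= 1 ->
    r < `|arc e (s_ e + (2 * t - 1) * (1 - s_ e))|.
  by move=> eG xe th; have [_ _] := hs e eG xe; apply; exact: late.
have dG' : plane_drawing G pt arc'.
  split => //.
  - move=> e eG; have [ce Ie ends] := hE e eG.
    have [xe|nxe] := boolP (x \in e); last first.
      by rewrite (_ : arc' e = arc e) //; apply/funext => t; exact: out.
    have [s01 sr sl] := hs e eG xe; split.
    + apply: continuous_subspaceT => t; rewrite /arc' xe.
      apply: (@continuousZ _ _ _ (fun t : R => Num.min 1 (2 * t))
        (fun t => arc e (s_ e + Num.max 0 (2 * t - 1) * (1 - s_ e)))).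
        apply: (@continuous_min R R (cst 1) (fun t => 2 * t)); first exact: cst_continuous.
        exact: c2.
      apply: continuous_comp; last exact: cG.
      apply: cvgD; first exact: cvg_cst.
      apply: cvgM; last exact: cvg_cst.
      apply: (@continuous_max R R (cst 0) (fun t => 2 * t - 1)); first exact: cst_continuous.
      by apply: cvgB; [exact: c2 | exact: cvg_cst].
    + move=> t u; rewrite !in_itv /= => t01 u01.
      have [[th Et]|[th Et]] := cas e t eG xe t01;
        have [[uh Eu]|[uh Eu]] := cas e u eG xe u01; rewrite Et Eu => tu.
      * have : 2 * t * r = 2 * u * r by rewrite -!(norm_early e) ?tu //; slra.
        by move/(mulIf (lt0r_neq0 r0)); slra.
      * have : `|(2 * t) *: arc e (s_ e)| <= r by rewrite norm_early //; snra.
        by rewrite tu leNgt norm_late //; slra.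
      * have : `|(2 * u) *: arc e (s_ e)| <= r by rewrite norm_early //; snra.
        by rewrite -tu leNgt norm_late //; slra.
      * have lt : s_ e < s_ e + (2 * t - 1) * (1 - s_ e) <= 1 by apply: late => //; slra.
        have lu : s_ e < s_ e + (2 * u - 1) * (1 - s_ e) <= 1 by apply: late => //; slra.
        move/Ie: tu; rewrite !in_itv /=.
        have -> /= : 0 <= s_ e + (2 * t - 1) * (1 - s_ e) <= 1 by slra.
        have -> /= : 0 <= s_ e + (2 * u - 1) * (1 - s_ e) <= 1 by slra.
        by move=> /(_ isT isT); snra.
    + rewrite -ends.
      have [[_ ->]|[h _]] := cas e 0 eG xe i0; last first.
        by exfalso; clear - h; lra.
      have [[h _]|[_ ->]] := cas e 1 eG xe i1.
        by exfalso; clear - h; lra.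
      by rewrite mulr0 scale0r arcx //; congr [set 0; arc e _]; slra.
  - move=> e u t eG; rewrite in_itv /= => t01.
    have [xe|nxe] := boolP (x \in e); last by rewrite out //; apply: hV.
    have [s01 sr sl] := hs e eG xe.
    have [|[th ->]|[th ->]] := cas e t eG xe; first by slra.
      move=> /(congr1 Num.norm); rewrite norm_early //; last by slra.
      have [->|/hpt] := eqVneq u x; first by rewrite ptx normr0; snra.
      by move=> + h; rewrite -h; snra.
    have l : s_ e < s_ e + (2 * t - 1) * (1 - s_ e) <= 1 by apply: late => //; slra.
    by apply: hV => //; rewrite in_itv /=; snra.
  - move=> e f s t eG fG ef; rewrite !in_itv /= => s01 t01.
    have [xe|nxe] := boolP (x \in e); have [xf|nxf] := boolP (x \in f).
    + have [sle _ _] := hs e eG xe; have [slf _ _] := hs f fG xf.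
      have [|[sh ->]|[sh ->]] := cas e s eG xe; first (by slra);
        (have [|[th ->]|[th ->]] := cas f t fG xf; first by slra) => st.
      (* Two radii: equal norms force equal times, so the exit points of [e] and [f] would
         coincide. *)
      * have : 2 * s * r = 2 * t * r.
          by rewrite -(norm_early e) -?(norm_early f) ?st //; slra.
        move/(mulIf (lt0r_neq0 r0)) => s2t2; move: st; rewrite s2t2.
        have t2 : 2 * t != 0 by apply: lt0r_neq0; slra.
        by move=> /(scalerI t2); exact: hA.
      * have : `|(2 * s) *: arc e (s_ e)| <= r by rewrite norm_early //; snra.
        by rewrite st leNgt norm_late //; slra.
      * have : `|(2 * t) *: arc f (s_ f)| <= r by rewrite norm_early //; snra.
        by rewrite -st leNgt norm_late //; slra.
      * move: st; apply: hA => //; rewrite in_itv /=; snra.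
    + rewrite (out f) //; have [sle _ _] := hs e eG xe.
      have [|[sh ->]|[sh ->]] := cas e s eG xe; first (by slra); last first.
        by apply: hA => //; rewrite in_itv /=; snra.
      have tr : r < `|arc f t| by apply: harc => //; rewrite in_itv /=; slra.
      by move=> st; move: tr; rewrite -st norm_early //; snra.
    + rewrite (out e) //; have [slf _ _] := hs f fG xf.
      have [|[sh ->]|[sh ->]] := cas f t fG xf; first (by slra); last first.
        by apply: hA => //; rewrite in_itv /=; snra.
      have sr : r < `|arc e s| by apply: harc => //; rewrite in_itv /=; slra.
      by move=> st; move: sr; rewrite st norm_early //; snra.
    + by rewrite !out //; exact: hA.
(* The radius towards a point of the square that is no exit point stays free. *)
have [q [qr hq]] : exists q : R * R, `|q| = r /\
    forall e, e \in edges G -> x \in e -> q != arc e (s_ e).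
  have [q [qr hq]] := free_direction (fun e => arc e (s_ e)) r0.
  by exists q; split => // e _ _; exact: hq.
exists arc', q; split => //; first by rewrite -normr_gt0 qr.
move=> t t01; have tr : `|t *: q| = t * r by rewrite normrZ qr ger0_norm //; slra.
have tr0 : 0 < t * r <= r by snra.
case=> [[u tu]|[e [s [eG s01 ts]]]].
  have [ux|/hpt] := eqVneq u x; last by rewrite -tu tr; slra.
  by move: tr0; rewrite -tr tu ux ptx normr0; slra.
have [xe|nxe] := boolP (x \in e); last first.
  have := harc e eG nxe s s01; rewrite -(out e) // -ts tr; slra.
move: s01; rewrite in_itv /= => s01.
have [[sh Es]|[sh Es]] := cas e s eG xe s01; last first.
  by have := norm_late e s eG xe; rewrite -Es -ts tr; slra.
have : 2 * s * r = t * r by rewrite -(norm_early e) // -?Es -?ts ?tr //; slra.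
move/(mulIf (lt0r_neq0 r0)) => s2t; move: ts; rewrite Es s2t.
have t0 : t != 0 by apply: lt0r_neq0; slra.
by move=> /(scalerI t0); apply/eqP; exact: hq.
Unshelve. all: by end_near. Qed.

End Straighten.

(** * Joining two components by an edge *)

Section Join.
Context {R : realType} {n : nat}.
Implicit Types (G : sgraph n) (pt : 'I_n -> R * R)
  (arc : {set 'I_n} -> R -> R * R) (e f : {set 'I_n}).

Lemma pair_continuous (T : topologicalType) (f g : T -> R) (z : T) :
  {for z, continuous f} -> {for z, continuous g} ->
  {for z, continuous (fun z => (f z, g z))}.
Proof. by move=> cf cg; exact: (cvg_pair cf cg). Qed.

(** A normal form at [x]: with the vertex at the origin and the free radius on the first axis, two
    such drawings can be glued along that axis. *)
Lemma straighten G (x : 'I_n) : planar R G -> exists pt arc,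
  [/\ plane_drawing G pt arc, pt x = 0 &
      forall t : R, 0 < t <= 1 -> ~ drawn_set G pt arc (t, 0)].
Proof.
move=> [pt [arc d0]].
have d1 : plane_drawing G (fun u => pt u - pt x) (fun e t => arc e t - pt x).
  apply: (@drawing_map _ _ _ _ _ (fun z => z - pt x)) => //.
    by move=> z _; apply: cvgB; [exact: cvg_id | exact: cvg_cst].
  by move=> z w _ _ /addIr.
set pt1 := fun u => pt u - pt x in d1; set arc1 := fun e t => _ in d1.
have pt1x : pt1 x = 0 by rewrite /pt1 subrr.
(* An arc at [x] that does not start at the origin must end there, so exactly these are reversed. *)
have [arc2 [d2 c2 arc20]] := reorient (fun e => (x \in e) && (arc1 e 0 != 0)) d1.
have [|arc3 [q [d3 q0 free]]] := straighten_arcs d2 c2 pt1x.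
  move=> e eG xe; rewrite arc20 xe /=; have [//|/= ne0] := eqVneq (arc1 e 0) 0.
  have [a [b [eab _ ea eb]]] := arc_ends d1 eG.
  rewrite eb; move: xe; rewrite eab !inE => /orP[] /eqP xab; last by rewrite -xab.
  by case/eqP: ne0; rewrite ea -xab.
pose N := q.1 ^+ 2 + q.2 ^+ 2.
have N0 : N != 0.
  apply: contraNneq q0 => /eqP; rewrite paddr_eq0 ?sqr_ge0 // !sqrf_eq0.
  by case: (q) => a b /= /andP[/eqP -> /eqP ->].
(* Complex division by [q], which sends the free direction [q] to [(1, 0)]. *)
pose L (z : R * R) : R * R :=
  ((z.1 * q.1 + z.2 * q.2) / N, (z.2 * q.1 - z.1 * q.2) / N).
have LK z : z = ((L z).1 * q.1 - (L z).2 * q.2, (L z).1 * q.2 + (L z).2 * q.1).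
  by move: N0; rewrite /L /N; case: z => a b /= N0; congr pair; field.
exists (L \o pt1), (fun e => L \o arc3 e); split.
- apply: drawing_map => // [z _|z w _ _ Lzw]; last by rewrite (LK z) Lzw -LK.
  have c1 : {for z, continuous (fun z : R * R => z.1)} by exact: cvg_fst.
  have c2' : {for z, continuous (fun z : R * R => z.2)} by exact: cvg_snd.
  by apply: pair_continuous; apply: cvgM; try exact: cvg_cst;
    [apply: cvgD | apply: cvgB]; apply: cvgM => //; exact: cvg_cst.
- by rewrite /= pt1x /L /= !mul0r addr0 subr0 !mul0r.
- move=> t t01 /drawn_set_map[w sw tw]; apply: (free t t01); suff -> : t *: q = w by [].
  by rewrite (LK w) -tw /= !mul0r subr0 addr0; case: (q).
Qed.

(* [pt1], [arc1] draw the component of [x]; the image of [pt2], [arc2] under the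
   inversion [inv] about [p] draws the rest inside the disc of radius [c1] around [p]. *)
Lemma join_planar G H (x y : 'I_n) : ~~ connect (adj G) x y ->
  edges H = [set x; y]%SET |: edges G :> {set {set 'I_n}} ->
  planar R G -> planar R H.
Proof.
move=> nxy EH pG.
have xney : x != y by apply: contraNneq nxy => ->; exact: connect0.
have [pt1 [arc1 [D1 pt1x free1]]] := straighten x pG.
have [pt2 [arc2 [D2 pt2y free2]]] := straighten y pG.
pose p : R * R := (1, 0).
have p1 : 0 < (1 : R) <= 1 by rewrite ltr01 lexx.
have [c1 c10 far1] := drawn_set_away D1 (free1 1 p1).
have [c2 c20 far2] := drawn_set_away D2 (free2 1 p1).
have n1 : `|0 - p| = 1 :> R by rewrite sub0r normrN prod_normE /= normr1 normr0 max_l.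
have c21 : c2 <= 1 by rewrite -n1 -pt2y; apply: far2; exact: drawn_set_pt.
have c11 : c1 <= 1 by rewrite -n1 -pt1x; apply: far1; exact: drawn_set_pt.
(* The second drawing keeps distance at least [c2] from [p], so its inverse lies within
   [eps / c2 < c1] of [p], where the first drawing has no point. *)
pose eps := c1 * c2 / 2.
have eps0 : 0 < eps by rewrite /eps; nra.
have epsc : eps / c2 < c1 by rewrite ltr_pdivrMr // /eps; nra.
have eps1 : eps < 1 by rewrite /eps; nra.
pose inv (z : R * R) : R * R := p + (eps / `|z - p| ^+ 2) *: (z - p).
have inv_dist z : z != p -> `|inv z - p| = eps / `|z - p|.
  rewrite -subr_eq0 -normr_eq0 => zp.
  have e0 : 0 <= eps / `|z - p| ^+ 2 by rewrite divr_ge0 ?sqr_ge0 // ltW.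
  by rewrite /inv addrAC subrr add0r normrZ ger0_norm //; field.
have S2p z : drawn_set G pt2 arc2 z -> z != p.
  by move=> sz; apply/eqP => zp; move: (far2 z sz); rewrite zp subrr normr0; lra.
have near2 z : drawn_set G pt2 arc2 z -> `|inv z - p| < c1.
  move=> sz; rewrite inv_dist ?S2p //; apply: le_lt_trans epsc.
  by rewrite ler_pM2l // lef_pV2 ?far2 // posrE ?(lt_le_trans c20) ?far2.
have disj z w : drawn_set G pt1 arc1 z -> drawn_set G pt2 arc2 w -> z <> inv w.
  by move=> /far1 + /near2 + zw; rewrite -zw; lra.
have invI : {in drawn_set G pt2 arc2 &, injective inv}.
  move=> z w; rewrite !inE => sz sw izw.
  have zw : `|z - p| = `|w - p|.
    have := inv_dist z (S2p z sz); rewrite izw inv_dist ?S2p //.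
    by move=> /(mulfI (lt0r_neq0 eps0)) /invr_inj.
  move: izw; rewrite /inv zw => /addrI /scalerI h; apply: (addIr (- p)); apply: h.
  rewrite mulf_neq0 ?lt0r_neq0 // ?invr_gt0 ?exprn_gt0 // normr_gt0 subr_eq0; exact: S2p.
have D3 : plane_drawing G (inv \o pt2) (fun e => inv \o arc2 e).
  apply: drawing_map => // z /S2p zp.
  have cz : {for z, continuous (fun z : R * R => z - p)}.
    by apply: cvgB; [exact: cvg_id | exact: cvg_cst].
  apply: cvgD; first exact: cvg_cst.
  apply: cvgZ => //; apply: cvgM; first exact: cvg_cst.
  apply: cvgV; first by rewrite expf_neq0 // normr_eq0 subr_eq0.
  by apply: (@continuousM _ _ (fun z : R * R => `|z - p|) (fun z : R * R => `|z - p|));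
    exact: cvg_norm cz.
have inv_y : inv (pt2 y) = (1 - eps, 0).
  rewrite pt2y /inv n1 expr1n divr1 /p; congr pair => /=; rewrite ?sub0r ?oppr0.
    by rewrite scalerN /= [eps *: _]mulr1.
  by rewrite scaler0 addr0.
(* If [inv (a, b)] were on the axis to the left of the image of [y], then [b = 0] and the distances
   of the two points to [p] would multiply to [eps]. The distance of the image exceeds [eps], so
   [0 < a < 1], and [(a, 0)] is on the free radius of [y]. *)
have seg2 (t : R) z : t < 1 -> drawn_set G pt2 arc2 z -> inv z <> (t * (1 - eps), 0).
  move=> t1 sz; have zp := S2p z sz; have dz := far2 z sz.
  rewrite /inv /p; move: dz; rewrite /p; case: z sz {zp} => a b sz /=.
  set d := `|_| => dz [ha hb].
  have d0 : 0 < d by lra.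
  have b0 : b = 0.
    move: hb => /eqP; rewrite add0r subr0 mulf_eq0 => /orP[|/eqP//].
    by rewrite mulf_eq0 invr_eq0 expf_eq0 /= !gt_eqF.
  have a1 : a < 1.
    rewrite ltNge; apply/negP => a1.
    have : 0 <= eps / d ^+ 2 * (a - 1).
      by rewrite mulr_ge0 ?subr_ge0 // divr_ge0 ?sqr_ge0 // ltW.
    move: ha; rewrite /GRing.scale /=; nra.
  have dE : d = 1 - a.
    by rewrite /d prod_normE /= b0 subr0 normr0 max_l // ltr0_norm; lra.
  have da : (1 - a) * (1 - t * (1 - eps)) = eps.
    have k0 : 1 - a != 0 by rewrite gt_eqF ?subr_gt0.
    have -> : t * (1 - eps) = 1 - eps / (1 - a) by rewrite -ha /GRing.scale /= dE; field.
    by field.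
  have w0 : eps < 1 - t * (1 - eps) by clear - t1 eps1; nra.
  have a0 : 0 < a by clear - w0 da eps0; nra.
  by apply: (free2 a); [lra | rewrite -b0].
pose A u := connect (adj G) x u.
have csym := conn_sym G.
have Ax : A x by exact: connect0.
have Ay : ~~ A y by [].
have A_edge e : e \in edges G -> {in e &, forall u v, A u = A v}.
  move=> eG u v ue ve; rewrite /A; apply: same_connect_r => //.
  have [->|uv] := eqVneq u v; first exact: connect0.
  apply: connect1; rewrite /adj (_ : [set u; v]%SET = e) //.
  apply/eqP; rewrite eqEcard (edge_card eG) cards2 uv leqnn andbT.
  by apply/fintype.subsetP => w; rewrite !inE => /orP[] /eqP ->.
pose exy : {set 'I_n} := [set x; y]%SET.
(* The new arc is selected below by testing equality with [exy], which must therefore not be an old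
   edge. *)
have nexy : exy \notin edges G.
  apply: contraNN Ay => h; rewrite -(A_edge _ h x y) // !inE eqxx //.
  by rewrite orbT.
pose inA e := [exists u in e, A u].
have inAE e u : e \in edges G -> u \in e -> inA e = A u.
  move=> eG ue; apply/idP/idP => [/existsP[v /andP[ve Av]]|Au].
    by rewrite (A_edge e eG u v).
  by apply/existsP; exists u; rewrite ue.
pose pt u := if A u then pt1 u else inv (pt2 u).
pose arc e (t : R) := if e == exy then (t * (1 - eps), 0)
  else if inA e then arc1 e t else inv (arc2 e t).
have [ptI1 hE1 hV1 hA1] := D1; have [ptI3 hE3 hV3 hA3] := D3.
have arcA e t : e \in edges G -> inA e -> arc e t = arc1 e t.
  by rewrite /arc; case: eqP => [->|_ _ ->//]; rewrite (negPf nexy).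
have arcB e t : e \in edges G -> ~~ inA e -> arc e t = inv (arc2 e t).
  by rewrite /arc; case: eqP => [->|_ _ /negPf ->//]; rewrite (negPf nexy).
have arcxy (t : R) : arc exy t = (t * (1 - eps), 0) by rewrite /arc eqxx.
have oc (t : R) : t \in `]0, 1[ -> t \in `[0, 1] := @subset_itv_oo_cc _ _ _ _ t.
have segpt t u : t \in `]0, 1[ -> (t * (1 - eps), 0) <> pt u.
  rewrite in_itv /= => t01; rewrite /pt; case: ifP => Au.
    by move=> h; apply: (free1 (t * (1 - eps))); [nra | rewrite h; exact: drawn_set_pt].
  by move=> /esym; apply: seg2; [lra | exact: drawn_set_pt].
have segarc t s e : t \in `]0, 1[ -> s \in `]0, 1[ -> e \in edges G ->
    (t * (1 - eps), 0) <> arc e s.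
  move=> t01i s01 eG; have t01 : 0 < t < 1 by move: t01i; rewrite in_itv.
  have [ie|ie] := boolP (inA e).
    rewrite arcA // => h; apply: (free1 (t * (1 - eps))); first by nra.
    by rewrite h; apply: drawn_set_arc => //; exact: oc.
  by rewrite arcB // => /esym; apply: seg2; [lra | apply: drawn_set_arc => //; exact: oc].
have e1 : 1 - eps != 0 by rewrite gt_eqF // subr_gt0.
exists pt, arc; split.
- move=> u v; rewrite /pt; case: ifP => Au; case: ifP => Av.
  + exact: ptI1.
  + by move=> /disj []; exact: drawn_set_pt.
  + by move=> /esym /disj []; exact: drawn_set_pt.
  + exact: ptI3.
- move=> e; rewrite EH !finset.in_setU1 => /orP[/eqP ->|eG].
    rewrite -/exy; split.
    + apply: continuous_subspaceT.
      rewrite (_ : arc exy = fun t => (t * (1 - eps), 0)); last exact/funext.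
      suff h (t : R) : {for t, continuous (fun t : R => (t * (1 - eps), (0 : R)))} by exact: h.
      apply: pair_continuous; last exact: cvg_cst.
      by apply: cvgM; [exact: cvg_id | exact: cvg_cst].
    + by move=> s t _ _; rewrite !arcxy => -[] /(mulIf e1).
    + rewrite !arcxy mul0r mul1r -inv_y (_ : (0, 0) = pt1 x); last by rewrite pt1x.
      by rewrite image_pair /pt Ax (negPf Ay).
  have [a [b [eab ab ea eb]]] := arc_ends D1 eG.
  have [a' [b' [eab' ab' ea' eb']]] := arc_ends D2 eG.
  have [ie|ie] := boolP (inA e).
    have [ce Ie ends] := hE1 e eG.
    rewrite (_ : arc e = arc1 e); last by apply/funext => t; exact: arcA.
    split => //; rewrite ends; apply/seteqP; split=> z [u ue <-]; exists u => //;
      by rewrite /pt -(inAE e) // ie.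
  have [ce Ie ends] := hE3 e eG.
  rewrite (_ : arc e = inv \o arc2 e); last by apply/funext => t; exact: arcB.
  split => //; rewrite ends; apply/seteqP; split=> z [u ue <-]; exists u => //;
    by rewrite /pt -(inAE e) // (negPf ie).
- move=> e u t; rewrite EH !finset.in_setU1 => /orP[/eqP ->|eG] t01.
    by rewrite -/exy arcxy; exact: segpt.
  have se1 := drawn_set_arc pt1 arc1 eG (oc t t01).
  have se2 := drawn_set_arc pt2 arc2 eG (oc t t01).
  have [ie|ie] := boolP (inA e); [rewrite arcA // | rewrite arcB //];
    rewrite /pt; case: ifP => Au.
  + exact: hV1.
  + by apply: disj => //; exact: drawn_set_pt.
  + by apply/nesym; apply: disj => //; exact: drawn_set_pt.
  + exact: hV3.
- move=> e f s t; rewrite EH !finset.in_setU1 => /orP[/eqP ->|eG] /orP[/eqP ->|fG] ef s01 t01.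
  + by rewrite eqxx in ef.
  + by rewrite -/exy arcxy; exact: segarc.
  + by rewrite -/exy arcxy; apply/nesym; exact: segarc.
  + have se1 := drawn_set_arc pt1 arc1 eG (oc s s01).
    have se2 := drawn_set_arc pt2 arc2 eG (oc s s01).
    have sf1 := drawn_set_arc pt1 arc1 fG (oc t t01).
    have sf2 := drawn_set_arc pt2 arc2 fG (oc t t01).
    have [ie|ie] := boolP (inA e); have [jf|jf] := boolP (inA f).
    * rewrite !arcA //; exact: hA1.
    * by rewrite arcA // arcB //; exact: disj.
    * by rewrite arcB // arcA //; apply/nesym; exact: disj.
    * rewrite !arcB //; exact: hA3.
Qed.

End Join.

(** * Switchings *)

Section Counting.
Local Open Scope nat_scope.

Lemma card_dep_pairs (T U : finType) (F : {set T}) (S : T -> {set U}) :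
  #|[set p : T * U | (p.1 \in F) && (p.2 \in S p.1)]%SET| = \sum_(t in F) #|S t|.
Proof.
rewrite -sum1_card; under [RHS]eq_bigr do rewrite -sum1_card.
by rewrite pair_big_dep /=; apply: eq_bigl => p; rewrite inE.
Qed.

(** Double counting: a switching [(t, u)] is sent injectively to [(f t u, g u)], where the label
    [g u] is what is needed to undo it. Each [t] in [F] has at least [c / w] switchings, each result
    at most [r] labels; the weight [w] avoids division. *)
Lemma switching_bound (T U V : finType) (F A : {set T}) (S : T -> {set U})
    (Z : T -> {set V}) (f : T -> U -> T) (g : U -> V) (c w r : nat) :
  (forall t u, t \in F -> u \in S t -> f t u \in A /\ g u \in Z (f t u)) ->
  (forall t u t' u', t \in F -> u \in S t -> t' \in F -> u' \in S t' ->
     f t u = f t' u' -> g u = g u' -> (t, u) = (t', u')) ->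
  (forall t, t \in F -> c <= w * #|S t|) ->
  (forall t, t \in A -> #|Z t| <= r) ->
  #|F| * c <= w * (#|A| * r).
Proof.
move=> fAZ fI cS Zr.
apply: (@leq_trans (w * \sum_(t in F) #|S t|)).
  by rewrite big_distrr /= -sum_nat_const; apply: leq_sum.
rewrite leq_mul2l; apply/orP; right.
apply: (@leq_trans (\sum_(t in A) #|Z t|)); last first.
  by rewrite -sum_nat_const; apply: leq_sum.
rewrite -!card_dep_pairs.
pose phi (p : T * U) := (f p.1 p.2, g p.2).
rewrite -(@card_in_imset _ _ phi); last first.
  move=> [t u] [t' u']; rewrite !inE /= => /andP[tF uS] /andP[tF' uS'] [].
  exact: fI.
apply: subset_leq_card; apply/fintype.subsetP => q /imsetP[[t u]].
by rewrite inE /= => /andP[tF uS] ->; rewrite inE /=; have [-> ->] := fAZ t u tF uS.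
Qed.

Lemma set2_eq (T : finType) (x y u v : T) : x != y ->
  ([set u; v] == [set x; y])%SET = (u == x) && (v == y) || (u == y) && (v == x).
Proof.
move=> xy; apply/idP/idP => [/eqP E|]; last first.
  by case/orP => /andP[/eqP -> /eqP ->] //; rewrite finset.setUC.
have := in_set2 u x y; rewrite -E set21 => /esym uxy.
have := in_set2 v x y; rewrite -E set22 => /esym vxy.
have := set21 x y; have := set22 x y; rewrite -E !inE.
move: uxy vxy xy; case/orP => /eqP ->; case/orP => /eqP -> xy;
  by rewrite ?eqxx ?(negPf xy) ?orbT //= ?[y == x]eq_sym ?(negPf xy).
Qed.

(** * Adding and deleting edges, degrees and the hub *)

Section Graphs.
Context {n : nat}.
Implicit Types (G H : sgraph n) (x y u v a b : 'I_n).

Definition nbrs G x : {set 'I_n} := [set y | adj G x y]%SET.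

Lemma adj_irr G x : adj G x x = false.
Proof. by apply/negP => /edge_card; rewrite finset.setUid cards1. Qed.

Lemma adj_neq G x y : adj G x y -> x != y.
Proof. by apply: contraTneq => ->; rewrite adj_irr. Qed.

Lemma sgraph_inj : injective (@edges n).
Proof. exact: val_inj. Qed.

(** The default of [insubd] is returned when [x = y]: adding a loop leaves [G] unchanged. *)
Definition add_edge G x y : sgraph n := insubd G ([set x; y] |: edges G)%SET.

Definition del_edge G x y : sgraph n := insubd G (edges G :\ [set x; y])%SET.

Lemma edges_add G x y : x != y -> edges (add_edge G x y) = ([set x; y] |: edges G)%SET.
Proof.
move=> xy; rewrite /add_edge -[LHS]/(val _) val_insubd ifT //.
apply/forall_inP => e; rewrite in_setU1 => /orP[/eqP ->|/edge_card ->//].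
by rewrite cards2 xy.
Qed.

Lemma edges_del G x y : edges (del_edge G x y) = (edges G :\ [set x; y])%SET.
Proof.
rewrite /del_edge -[LHS]/(val _) val_insubd ifT //.
by apply/forall_inP => e; rewrite in_setD1 => /andP[_ /edge_card ->].
Qed.

Lemma adj_add G x y u v : x != y ->
  adj (add_edge G x y) u v =
  (u == x) && (v == y) || (u == y) && (v == x) || adj G u v.
Proof. by move=> xy; rewrite /adj edges_add // in_setU1 set2_eq. Qed.

Lemma del_edgeK G x y : adj G x y -> add_edge (del_edge G x y) x y = G.
Proof.
move=> xy; apply: sgraph_inj; rewrite edges_add ?(adj_neq xy) // edges_del.
exact: finset.setD1K.
Qed.

Lemma adj_del G x y : adj (del_edge G x y) x y = false.
Proof. by rewrite /adj edges_del in_setD1 eqxx. Qed.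

Lemma deg_nbrs G x : deg G x = #|nbrs G x|.
Proof.
apply: fintype.eq_card => y; rewrite [RHS]inE.
by apply/idP/idP => [/set_mem|/mem_set].
Qed.

Lemma deg_add G x y u : x != y -> ~~ adj G x y ->
  deg (add_edge G x y) u = deg G u + ((u == x) || (u == y)).
Proof.
move=> xy nxy; rewrite !deg_nbrs.
have [->|ux] /= := eqVneq u x.
  rewrite (_ : nbrs _ x = y |: nbrs G x)%SET ?cardsU1 ?inE ?nxy 1?addnC //.
  by apply/setP => z; rewrite !inE adj_add // eqxx (negPf xy) /= orbF.
have [->|uy] /= := eqVneq u y.
  rewrite (_ : nbrs _ y = x |: nbrs G y)%SET ?cardsU1 ?inE 1?adj_sym ?nxy 1?addnC //.
  by apply/setP => z; rewrite !inE adj_add // eqxx [y == x]eq_sym (negPf xy).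
rewrite addn0 (_ : nbrs (add_edge G x y) u = nbrs G u) //; apply/setP => z.
by rewrite !inE adj_add // (negPf ux) (negPf uy).
Qed.

Lemma deg_lt G x : deg G x < n.
Proof.
rewrite -[X in _ < X]card_ord -cardsT (cardsD1 x) inE add1n ltnS deg_nbrs.
apply: subset_leq_card; apply/fintype.subsetP => y; rewrite !inE andbT => /adj_neq.
by rewrite eq_sym.
Qed.

Lemma min_deg_le G x : min_deg G <= deg G x.
Proof.
rewrite /min_deg; have := mem_index_enum x; move: (index_enum _) => s.
elim: s => // z s IHs; rewrite inE big_cons => /orP[/eqP <-|/IHs xs].
  exact: geq_minl.
exact: leq_trans (geq_minr _ _) xs.
Qed.

Lemma min_deg_witness G : 0 < n -> exists w, deg G w = min_deg G.
Proof.
move=> n0; pose w := [arg min_(w < Ordinal n0) deg G w].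
exists w; apply/eqP; rewrite eqn_leq min_deg_le andbT.
rewrite /w; case: arg_minnP => // {}w _ wmin.
rewrite /min_deg; elim/big_rec: _ => [|i m _ IH]; first exact/ltnW/deg_lt.
by rewrite leq_min wmin.
Qed.

Lemma deg_le_max G x : deg G x <= max_deg G.
Proof. exact: leq_bigmax. Qed.

Lemma max_deg_eq G m v : deg G v = m -> (forall u, deg G u <= m) -> max_deg G = m.
Proof.
move=> <- dm; apply/eqP; rewrite eqn_leq deg_le_max andbT.
by apply/bigmax_leqP.
Qed.

(* [pick] only depends on the set of vertices of maximum degree, so a switching
   that preserves this set preserves the hub. *)
Definition hub G : option 'I_n := [pick v | deg G v == max_deg G].

Lemma hubP G : 0 < n -> exists2 v, hub G = Some v & deg G v = max_deg G.
Proof.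
move=> n0; rewrite /hub; case: pickP => [v /eqP vm|none]; first by exists v.
have [|v vm] := @bigop.eq_bigmax _ (deg G); first by rewrite card_ord.
by have := none v; rewrite /max_deg vm eqxx.
Qed.

Lemma hub_deg G v : hub G = Some v -> deg G v = max_deg G.
Proof. by rewrite /hub; case: pickP => // u /eqP um [<-]. Qed.

Lemma hub_eq G H : (forall v, (deg G v == max_deg G) = (deg H v == max_deg H)) ->
  hub G = hub H.
Proof. by move=> GH; apply: eq_pick. Qed.

(** In the switched graph, the added edge leads from [y] to its only neighbour that is joined to [v]
    by a path avoiding [y]. *)
Lemma add_edge_inj G1 G2 v x1 x2 y :
  connect (adj G1) v x1 -> ~~ connect (adj G1) v y ->
  connect (adj G2) v x2 -> ~~ connect (adj G2) v y ->
  add_edge G1 x1 y = add_edge G2 x2 y -> (G1, x1) = (G2, x2).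
Proof.
move=> c1 n1 c2 n2 E.
have xy1 : x1 != y by apply: contraNneq n1 => <-.
have xy2 : x2 != y by apply: contraNneq n2 => <-.
have e1 : ~~ adj G1 x1 y.
  by apply: contra n1 => h; apply: connect_trans c1 (connect1 h).
have e2 : ~~ adj G2 x2 y.
  by apply: contra n2 => h; apply: connect_trans c2 (connect1 h).
have [xx|x12] := eqVneq x1 x2.
  congr pair => //; apply: sgraph_inj; rewrite -xx in E e2 xy2.
  by rewrite -(finset.setU1K e1) -(finset.setU1K e2) -!edges_add // E.
have adjE a b : adj (add_edge G1 x1 y) a b = adj (add_edge G2 x2 y) a b by rewrite E.
(* [x2 y] is an edge of [G1], and [x2] is still joined to [v] in [G1] since the
   component of [v] in [G2] avoids [y]. *)
have xy : adj G1 x2 y.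
  have := adjE x2 y; rewrite !adj_add // !eqxx eq_sym (negPf x12) (negPf xy2) /=.
  by move=> ->.
case/negP: n1; apply: connect_trans (connect1 xy).
have /connectP[p pp ->] := c2.
have : ~~ connect (adj G2) v y by [].
elim: p v pp {c1 c2 n2} => [|z p IHp] v /=; first by move=> _ _; exact: connect0.
move=> /andP[vz zp] nvy.
have nzy : ~~ connect (adj G2) z y.
  by apply: contra nvy => h; apply: connect_trans (connect1 vz) h.
apply: connect_trans (IHp z zp nzy); apply: connect1.
have vy : v != y by apply: contraNneq nvy => ->; exact: connect0.
have zy : z != y by apply: contraNneq nzy => ->; exact: connect0.
have := adjE v z; rewrite !adj_add // (negPf vy) (negPf zy) vz !andbF /=.
by move=> ->.
Qed.

End Graphs.
End Counting.

(** * Switchings inside the class *)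

Section Class.
Local Open Scope nat_scope.
Context {R : realType} {n : nat} {d1 d2 D1 D2 : int} {k : nat} {A : {set sgraph n}}.
Hypothesis AE : A = planar_class R n d1 d2 D1 D2.
Hypotheses (d1le : (d1 <= 5)%R) (d2gt : (0 < d2)%R) (D1ge : (n%:Z <= D1 + k%:Z)%R).
Hypotheses (k_gt0 : 0 < k) (k_small : 8 * k <= n) (n_large : 64 <= n).
Implicit Types (G H : sgraph n) (x y u v a b w : 'I_n).

Let n_gt0 : 0 < n. Proof. by lia. Qed.

Lemma planar_classP G :
  reflect [/\ planar R G, (d1 <= (min_deg G)%:Z)%R, ((min_deg G)%:Z <= d2)%R,
              (D1 <= (max_deg G)%:Z)%R & ((max_deg G)%:Z <= D2)%R] (G \in A).
Proof.
rewrite AE inE; apply: (iffP and3P) => [[/asboolP pG /andP[m1 m2] /andP[M1 M2]]|] //.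
by move=> [pG m1 m2 M1 M2]; split; rewrite ?m1 ?M1 //; apply/asboolP.
Qed.

Lemma class_hub_deg G v : G \in A -> hub G = Some v -> n <= deg G v + k.
Proof. by move=> /planar_classP[_ _ _ M _] /hub_deg ->; lia. Qed.

Lemma class_modify G H : G \in A -> planar R H ->
  (forall u, (d1 <= (deg H u)%:Z)%R) -> (exists w, ((deg H w)%:Z <= d2)%R) ->
  max_deg H = max_deg G -> H \in A.
Proof.
move=> /planar_classP[_ _ _ M1 M2] pH dH [w wH] E; apply/planar_classP; split => //.
- by have [w' <-] := min_deg_witness H n_gt0.
- by have := min_deg_le H w; lia.
- by rewrite E.
- by rewrite E.
Qed.

Lemma del_planar G a b : planar R G -> planar R (del_edge G a b).
Proof.
have sub e : e \in edges (del_edge G a b) -> e \in edges G.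
  by rewrite edges_del in_setD1 => /andP[].
move=> [pt [arc [ptI hE hV hA]]]; exists pt, arc; split => //.
- by move=> e /sub; exact: hE.
- by move=> e x t /sub; exact: hV.
- by move=> e f s t /sub eG /sub; exact: hA.
Qed.

Lemma deg_del G a b u : adj G a b ->
  deg G u = deg (del_edge G a b) u + ((u == a) || (u == b)).
Proof.
move=> ab; rewrite -deg_add ?(adj_neq ab) ?adj_del //.
by rewrite del_edgeK.
Qed.

(** The ends of the deleted edge keep degrees far above [5 >= d1], and the hub, being neither end,
    still attains the maximum degree. *)
Lemma del_class G v a b : G \in A -> hub G = Some v -> a != v -> b != v ->
  adj G a b -> n <= deg G a + k.+1 -> n <= deg G b + k.+1 -> del_edge G a b \in A.
Proof.
move=> GA hv av bv ab da db; have /planar_classP[pG m1 m2 M1 M2] := GA.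
have dd u := deg_del u ab.
apply: (class_modify GA (del_planar a b pG)) => [u||].
- have := dd u; have := min_deg_le G u.
  have [->|_] := eqVneq u a; first by lia.
  have [->|_] := eqVneq u b; by lia.
- by have [w dw] := min_deg_witness G n_gt0; exists w; have := dd w; lia.
- apply: (@max_deg_eq _ _ _ v) => [|u]; last by have := dd u; have := deg_le_max G u; lia.
  by have := dd v; rewrite -(hub_deg hv) eq_sym (negPf av) eq_sym (negPf bv) addn0.
Qed.

(* The last hypothesis keeps the minimum degree at most [d2]; an isolated vertex is
   harmless, since its degree becomes at most [1 <= d2]. *)
Lemma add_class G v x y : G \in A -> hub G = Some v ->
  connect (adj G) v x -> ~~ connect (adj G) v y -> v != x ->
  deg G x + 2 <= max_deg G ->
  (exists w, (((deg G w)%:Z <= d2)%R && (w \notin [:: x; y])) || (deg G w == 0)) ->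
  add_edge G x y \in A /\ hub (add_edge G x y) = Some v.
Proof.
move=> GA hv cx ncy vx dx [w hw]; have /planar_classP[pG m1 m2 M1 M2] := GA.
have vD := hub_deg hv; have vk := class_hub_deg GA hv.
have xy : x != y by apply: contraNneq ncy => <-.
have vy : v != y by apply: contraNneq ncy => <-; exact: connect0.
have nxy : ~~ connect (adj G) x y by apply: contra ncy; exact: connect_trans.
have naxy : ~~ adj G x y by apply: contra nxy => h; exact: connect1.
have dd u := deg_add u xy naxy.
(* Vertices in different components have disjoint neighbourhoods. As the hub has degree at least
   [n - k], this leaves [y] with degree at most [k]. *)
have dy : deg G y + deg G v <= n.
  rewrite !deg_nbrs -[X in _ <= X]card_ord -cardsUI.
  rewrite [X in _ + X](_ : _ = 0) ?addn0 ?max_card //.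
  apply/eqP; rewrite cards_eq0; apply/eqP/setP => z; rewrite !inE.
  apply/negP => /andP[yz vz]; case/negP: ncy.
  by apply: connect_trans (connect1 vz) _; rewrite conn_sym; exact: connect1.
have vdeg : deg (add_edge G x y) v = max_deg G.
  by rewrite dd (negPf vx) (negPf vy) addn0.
have ddx := dd x; have ddy := dd y; rewrite eqxx orbT in ddy; rewrite eqxx in ddx.
have ddyD : deg G y + 1 < max_deg G by clear -dy vk vD k_small n_large; lia.
have maxH : max_deg (add_edge G x y) = max_deg G.
  apply: (max_deg_eq vdeg) => u.
  have [->|ux] := eqVneq u x; first by clear -ddx dx; lia.
  have [->|uy] := eqVneq u y; first by clear -ddy ddyD; lia.
  by rewrite dd (negPf ux) (negPf uy) addn0 deg_le_max.
split.
  apply: (class_modify GA) => // [|u|].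
  - by apply: (join_planar nxy) pG; exact: edges_add.
  - by rewrite dd; have := min_deg_le G u; clear -m1; lia.
  - exists w; have := dd w; clear -hw d2gt; move: hw => /orP[/andP[w2 wn]|/eqP ->]; last by lia.
    by move: wn; rewrite !inE => /norP[/negPf -> /negPf ->]; lia.
(* Both [x] and [y] remain strictly below the maximum degree, so the set of vertices attaining it is
   unchanged. *)
rewrite -hv; apply/esym/hub_eq => u; rewrite maxH.
have [->|ux] := eqVneq u x; first by rewrite !ltn_eqF //; clear -ddx dx; lia.
have [->|uy] := eqVneq u y; first by rewrite !ltn_eqF //; clear -ddy ddyD; lia.
by rewrite dd (negPf ux) (negPf uy) addn0.
Qed.

(** The complement consists of the vertices that stay below the maximum degree after gaining an
    edge, as [add_class] requires of [x]. *)
Definition high G : {set 'I_n} := [set u | max_deg G <= deg G u + 1]%SET.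

Lemma card_nonnbrs G u : #|~: nbrs G u| + deg G u = n.
Proof. by rewrite deg_nbrs addnC cardsC card_ord. Qed.

Lemma many_high_bound :
  #|[set G in A | n <= 2 * #|high G|]%SET| * (n * n) <= 16 * (#|A| * (n * (k + 2))).
Proof.
pose S G := [set p : 'I_n * 'I_n | adj G p.1 p.2 && (n <= deg G p.1 + k.+1)
  && (del_edge G p.1 p.2 \in A)]%SET.
(* The vertex [a] loses a neighbour in the deletion, whence [k + 2] in place of [k.+1]; the
   non-neighbours counted include [a] itself. *)
pose Z H := [set p : 'I_n * 'I_n |
  (p.1 \in [set: 'I_n]%SET) && (p.2 \in if n <= deg H p.1 + (k + 2) then ~: nbrs H p.1 else finset.set0)]%SET.
apply: (@switching_bound _ _ _ _ A S Z (fun G p => del_edge G p.1 p.2) id).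
- move=> G [a b] _; rewrite !inE /= => /andP[/andP[ab da] ->]; split => //.
  have := deg_del a ab; rewrite eqxx => dd; rewrite ifT; last by lia.
  by rewrite !inE adj_del.
- move=> G [a b] G' [a' b'] _ pS _ pS' /= E [aa bb]; rewrite -aa -bb in pS' E *.
  move: pS pS'; rewrite !inE /= => /andP[/andP[ab _] _] /andP[/andP[ab' _] _].
  by congr pair; rewrite -(del_edgeK ab) E del_edgeK.
- move=> G; rewrite inE => /andP[GA Gh].
  have [v hv vD] := hubP G n_gt0.
  have vk := class_hub_deg GA hv.
  have hk u : u \in high G -> n <= deg G u + k.+1 by rewrite inE; lia.
  pose Hs := high G :\ v.
  have cHs : n <= 2 * #|Hs| + 2.
    by move: Gh (leq_b1 (v \in high G)); rewrite (cardsD1 v); move: #|Hs| (nat_of_bool _); clear; lia.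
  have : #|[set p : 'I_n * 'I_n | (p.1 \in Hs) && (p.2 \in Hs :&: nbrs G p.1)]%SET| <= #|S G|.
    apply: subset_leq_card; apply/fintype.subsetP => -[a b]; rewrite !inE /=.
    move=> /andP[/andP[av ah] /andP[/andP[bv bh] ab]]; rewrite ab /=.
    have da : n <= deg G a + k.+1 by apply: hk; rewrite inE.
    have db : n <= deg G b + k.+1 by apply: hk; rewrite inE.
    by rewrite da (del_class GA hv).
  rewrite (card_dep_pairs Hs (fun a => Hs :&: nbrs G a)) => SG; apply: (leq_trans _ (leq_mul (leqnn 16) SG)).
  (* Of the at least [n / 2 - 1] vertices of [Hs], at most [k + 1] are non-neighbours of [a], and
     [k <= n / 8]. *)
  have inner a : a \in Hs -> n <= 4 * #|Hs :&: nbrs G a|.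
    rewrite in_setD1 => /andP[_ /hk da].
    have := card_nonnbrs G a; have := cardsID (nbrs G a) Hs.
    have : #|Hs :\: nbrs G a| <= #|~: nbrs G a|.
      by apply: subset_leq_card; rewrite finset.setDE subsetIr.
    by lia.
  have : \sum_(a in Hs) n <= \sum_(a in Hs) 4 * #|Hs :&: nbrs G a| by apply: leq_sum.
  have hn : n <= 4 * #|Hs| by move: cHs; move: #|Hs|; clear -n_large; lia.
  rewrite -big_distrr sum_nat_const /=; have := leq_mul hn (leqnn n).
  by move: #|Hs| (\sum_(_ in _) _); clear; lia.
- move=> H _; rewrite (card_dep_pairs [set: 'I_n]%SET
    (fun a => if n <= deg H a + (k + 2) then ~: nbrs H a else finset.set0)).
  apply: (@leq_trans (\sum_(a in [set: 'I_n]%SET) (k + 2))).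
    apply: leq_sum => a _; case: ifP => da; last by rewrite cards0.
    by have := card_nonnbrs H a; lia.
  by rewrite sum_nat_const cardsT card_ord.
Qed.

Lemma few_high_bound :
  #|[set G in A | ~~ connected_graph G && (2 * #|high G| < n)]%SET| * n <= 4 * (#|A| * k).
Proof.
pose S G := [set p : 'I_n * 'I_n | [exists v, [&& hub G == Some v,
  hub (add_edge G p.1 p.2) == Some v, connect (adj G) v p.1,
  ~~ connect (adj G) v p.2, v != p.1 & add_edge G p.1 p.2 \in A]]]%SET.
(* Only [y] is kept as a label: the hub is the same before and after, and [add_edge_inj] then
   recovers [x] and [G]. *)
pose Z H := [set y : 'I_n | [exists v, (hub H == Some v) && ~~ adj H v y]]%SET.
apply: (@switching_bound _ _ _ _ A S Z (fun G p => add_edge G p.1 p.2) snd).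
- move=> G [x y] _; rewrite !inE /= => /existsP[v /and5P[_ hv cx ncy /andP[vx ->]]].
  split => //; apply/existsP; exists v; rewrite hv adj_add; last first.
    by apply: contraNneq ncy => <-.
  rewrite (negPf vx) /= negb_or andbC; apply/andP; split.
    by apply: contra ncy; exact: connect1.
  by apply/negP => /andP[/eqP vy _]; case/negP: ncy; rewrite vy; exact: connect0.
- move=> G [x y] G' [x' y'] _ + _ + /= + yy; rewrite -yy !inE /=.
  move=> /existsP[v /and5P[_ /eqP hv cx ncy _]].
  move=> /existsP[v' /and5P[_ /eqP hv' cx' ncy' _]] E.
  have vv : v' = v by move: hv'; rewrite -E hv => -[].
  by rewrite vv in cx' ncy'; have [-> ->] := add_edge_inj cx ncy cx' ncy' E.
- move=> G; rewrite inE => /and3P[GA ncG few].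
  have [v hv vD] := hubP G n_gt0.
  have vk := class_hub_deg GA hv.
  have /planar_classP[pG m1 m2 M1 M2] := GA.
  have [w dw] := min_deg_witness G n_gt0.
  have [z nz] : exists z, ~~ connect (adj G) v z.
    move: ncG; rewrite negb_forall => /existsP[x]; rewrite negb_forall => /existsP[z xz].
    have [vz|] := boolP (connect (adj G) v z); last by exists z.
    exists x; apply: contra xz => vx; apply: connect_trans vz.
    by rewrite conn_sym.
  (* The vertex [w] of minimum degree should keep its degree, so [y] is chosen different from it.
     This fails only if [w] is the sole vertex outside the component of the hub, and then [w] is
     isolated. *)
  have [y [ncy hy]] : exists y, ~~ connect (adj G) v y /\ (w != y \/ deg G w = 0).
    have [/existsP[y /andP[ncy wy]]|none] := boolP [exists y, ~~ connect (adj G) v y && (w != y)].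
      by exists y; split => //; left.
    have only y : ~~ connect (adj G) v y -> w = y.
      by move=> ncy; apply: contraNeq none => wy; apply/existsP; exists y; rewrite ncy.
    exists z; split => //; right; rewrite (only z nz) deg_nbrs; apply/eqP.
    rewrite cards_eq0; apply/eqP/setP => u; rewrite !inE; apply/negP => zu.
    have : ~~ connect (adj G) v u.
      by apply: contra nz => vu; apply: connect_trans vu _; rewrite conn_sym; exact: connect1.
    by move/only; rewrite (only z nz) => E; rewrite E adj_irr in zu.
  (* The hub has at least [n - k] neighbours, fewer than [n / 2] vertices are high, and removing [w]
     costs one more; at least [n / 4] choices remain. *)
  pose X := (nbrs G v :\: high G) :\ w.
  have cX : n <= 4 * #|X|.
    move: vk few (leq_b1 (w \in nbrs G v :\: high G)).
    rewrite deg_nbrs -(cardsID (high G)) (cardsD1 w (_ :\: _)) -/X.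
    have := subset_leq_card (subsetIr (nbrs G v) (high G)).
    move: #|X| (nat_of_bool _) #|_ :&: _| #|high G|.
    by clear -k_small n_large; lia.
  apply: leq_trans cX _; rewrite leq_mul2l /=.
  rewrite -(@card_imset _ _ (fun x => (x, y))); last by move=> x x' [].
  apply: subset_leq_card; apply/fintype.subsetP => p /imsetP[x xX ->{p}].
  move: xX; rewrite !inE -ltnNge => /and3P[xw xl vx].
  rewrite /=; have cx : connect (adj G) v x by exact: connect1.
  have vnx := adj_neq vx.
  have [||H1 H2] := @add_class G v x y GA hv cx ncy vnx.
  + by lia.
  + exists w; case: hy => [wy|->]; last by rewrite eqxx orbT.
    by rewrite dw m2 !inE negb_or [w == x]eq_sym xw wy.
  by apply/existsP; exists v; rewrite hv H2 !eqxx cx ncy vnx H1.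
- move=> H HA; have [v hv vD] := hubP H n_gt0.
  have vk := class_hub_deg HA hv; have := card_nonnbrs H v.
  have : #|Z H| <= #|~: nbrs H v|.
    apply: subset_leq_card; apply/fintype.subsetP => y; rewrite !inE => /existsP[u].
    by rewrite hv => /andP[/eqP[<-]].
  by lia.
Qed.

Lemma disconnected_bound :
  #|[set G in A | ~~ connected_graph G]%SET| * n <= 52 * (k * #|A|).
Proof.
have := many_high_bound; have := few_high_bound.
set F1 := #|[set G in A | _ && _]%SET|; set F2 := #|[set G in A | _ <= _]%SET|.
have : #|[set G in A | ~~ connected_graph G]%SET| <= F1 + F2.
  apply: (@leq_trans #|[set G in A | ~~ connected_graph G && (2 * #|high G| < n)]%SET
    :|: [set G in A | n <= 2 * #|high G|]%SET|); last by rewrite cardsU leq_subr.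
  apply: subset_leq_card; apply/fintype.subsetP => G; rewrite !inE.
  by move=> /andP[-> ->] /=; case: leqP => _; rewrite ?orbT.
set F := #|_|; move=> FF b1 b2.
(* As [k + 2 <= 3 * k], the factor 16 becomes 48; the 4 from the other case brings the total to
   52. *)
have b3 : F2 * n <= 48 * (k * #|A|).
  rewrite -(leq_pmul2r n_gt0) -mulnA; apply: leq_trans b2 _.
  have k3 : k + 2 <= 3 * k by lia.
  by have := leq_mul (leqnn (#|A| * n)) k3; move: #|A| => c; clear; nia.
by move: FF b1 b3; move: #|A| => c; clear; nia.
Qed.

End Class.

(** * Passage to the limit *)

Section Limit.
Context {R : realType}.

Lemma uniform_pr_bound (T : finType) (A : {set T}) (B : pred T) (c : R) :
  A != finset.set0 -> #|[set x in A | ~~ B x]%SET|%:R <= c * #|A|%:R ->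
  `|1 - uniform_pr R A B| <= c.
Proof.
move=> A0 Bc; have cA : 0 < (#|A|%:R : R) by rewrite ltr0n card_gt0.
rewrite /uniform_pr.
have split_card : #|A|%:R = #|[set x in A | B x]%SET|%:R + #|[set x in A | ~~ B x]%SET|%:R :> R.
  rewrite -natrD -(cardsID [set x | B x]%SET A); congr (_ + _)%:R; apply: fintype.eq_card => x.
    by rewrite !inE.
  by rewrite !inE andbC.
have -> : 1 - #|[set x in A | B x]%SET|%:R / #|A|%:R = #|[set x in A | ~~ B x]%SET|%:R / #|A|%:R :> R.
  by apply: (mulIf (lt0r_neq0 cA)); rewrite mulrBl mul1r !divfK ?gt_eqF // split_card addrC addKr.
by rewrite ger0_norm ?divr_ge0 // ler_pdivrMr.
Qed.

End Limit.

(** The limit runs over the [n] with a nonempty class, where a uniformly random member exists. *)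
Theorem theorem20p1 (R : realType) (d1 d2 D1 D2 : nat -> int)
  (ha : \forall n \near \oo,
      d1 n <= Num.min 5 (Num.min (d2 n) (D2 n)) /\ D1 n <= D2 n)
  (hb : \forall n \near \oo, 0 < d2 n)
  (hD1 : (fun n : nat => n%:R - (D1 n)%:~R : R^o) =o_\oo
         (fun n : nat => n%:R : R^o)) :
  uniform_pr R (planar_class R n (d1 n) (d2 n) (D1 n) (D2 n))
    (@connected_graph n)
  @[n --> within
      [set n | planar_class R n (d1 n) (d2 n) (D1 n) (D2 n) != finset.set0] \oo]
  --> (1 : R).
Proof.
apply/cvgrPdist_le => e e0.
(* With [k <= 2 * eta * n], the bound [52 * k / n] is at most [104 * eta <= e], and
   [8 * k <= 16 * eta * n <= n]. *)
pose eta := Num.min (e / 104) (1 / 16).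
have eta0 : 0 < eta by rewrite lt_min divr_gt0 //= divr_gt0.
have /eqoP /(_ _ eta0) hsmall := hD1.
have hlarge : \forall n \near \oo, eta^-1 <= (n%:R : R) by exact: nbhs_infty_ger.
rewrite /= near_withinE.
near=> n => A0.
have [hd1 _] : d1 n <= Num.min 5 (Num.min (d2 n) (D2 n)) /\ D1 n <= D2 n by near: n.
have hd2 : 0 < d2 n by near: n.
have hs : `|n%:R - (D1 n)%:~R| <= eta * `|n%:R : R| by near: n.
have hl : eta^-1 <= (n%:R : R) by near: n.
have n64 : (64 <= n)%N by near: n; exact: nbhs_infty_ge.
(* The successor makes [k] positive; its cost is absorbed by [1 <= eta * n]. *)
pose k := (`|n%:Z - D1 n|%N).+1.
have hk : k%:R <= 2 * eta * n%:R :> R.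
  have eta_n : 1 <= eta * n%:R by rewrite mulrC -ler_pdivrMr // div1r.
  rewrite /k -natr1 natr_absz intr_norm rmorphB /=.
  by move: hs; rewrite normr_nat; lra.
have hkn : (8 * k <= n)%N.
  rewrite -(ler_nat R) natrM; apply: le_trans (_ : 8 * (2 * eta * n%:R) <= _).
    by rewrite ler_wpM2l.
  rewrite !mulrA ler_piMl // -mulrA.
  have : eta <= 1 / 16 by rewrite ge_min lexx orbT.
  lra.
apply: uniform_pr_bound => //.
have d1le : d1 n <= 5 by move: hd1; rewrite le_min => /andP[].
have D1ge : n%:Z <= D1 n + k%:Z by lia.
have := @disconnected_bound R n _ _ _ (D2 n) k _ erefl d1le hd2 D1ge isT hkn n64.
rewrite -(ler_nat R) !natrM => db.
have n0 : 0 < (n%:R : R) by rewrite ltr0n; lia.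
rewrite -(ler_pM2r n0); apply: le_trans db _.
rewrite mulrA [leRHS]mulrAC ler_wpM2r //.
apply: le_trans (_ : 52 * (2 * eta * n%:R) <= _); first by rewrite ler_wpM2l.
rewrite !mulrA ler_wpM2r //.
have : eta <= e / 104 by rewrite ge_min lexx.
lra.
Unshelve. all: by end_near. Qed.
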